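(* Let $B=(V,E)$ be a generalized Bratteli diagram defined by a sequence of incidence matrices $(F_n)_{n\ge 0}$, and let $A_n=F_n^T$ be the transpose of $F_n$. Let $\mu$ be a tail invariant Borel probability measure on the path-space $X_B$, and define vectors $\mu^{(n)}=(\mu^{(n)}_v: v\in V_n)$ by $\mu^{(n)}_v=\mu([\overline e])$ for any $\overline e\in E(V_0,v)$, $v\in V_n$, $n\ge 0$. Then $$A_n\mu^{(n+1)}=\mu^{(n)},\qquad n\ge 0 .$$ Conversely, if a sequence of non-negative vectors $\mu^{(n)}=(\mu^{(n)}_v: v\in V_n)$, $n\ge 0$, satisfies $A_n\mu^{(n+1)}=\mu^{(n)}$ for all $n\ge 0$, then it defines a unique tail invariant measure $\mu$ on $X_B$, via $\mu([\overline e])=\mu^{(n)}_v$ for all $\overline e\in E(V_0,v)$, $v\in V_n$. The theorem remains true for $\sigma$-finite measures $\nu$ on $X_B$ satisfying $\nu([\overline e])<\infty$ for every cylinder set $[\overline e]$.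
   Context: A generalized Bratteli diagram $B=(V,E)$ is a graded graph with $V=\bigsqcup_{n\ge0}V_n$, each $V_n$ being a copy of a fixed countably infinite set $V_0$, and $E=\bigsqcup_{n\ge 0}E_n$, where $E_n$ is the set of edges between $V_n$ and $V_{n+1}$. Each $e\in E_n$ has a source $s(e)\in V_n$ and a range $r(e)\in V_{n+1}$. For $w\in V_n$, $v\in V_{n+1}$ the set $E(w,v)$ of edges with source $w$ and range $v$ is finite (possibly empty), and $f^{(n)}_{vw}=|E(w,v)|$. The incidence matrix $F_n=(f^{(n)}_{vw}: v\in V_{n+1}, w\in V_n)$ has only finitely many non-zero entries in each row and has no zero row and no zero column. The path-space $X_B$ is the set of infinite paths $x=(x_i)_{i\ge0}$, $x_i\in E_i$, $r(x_i)=s(x_{i+1})$, with the (Polish, zero-dimensional) topology whose base consists of the cylinder sets $[\overline e]=\{x\in X_B: x_0=e_0,\dots,x_n=e_n\}$, $\overline e=(e_0,\dots,e_n)$ a finite path. For $v\in V_n$, $E(V_0,v)$ denotes the set of finite paths from $V_0$ to $v$; for $n=0$ it consists of the path of length zero at $v$, whose cylinder set is $\{x\in X_B: s(x_0)=v\}$. A Borel measure $\mu$ on $X_B$ is tail invariant if $\mu([\overline e])=\mu([\overline e'])$ for any two finite paths $\overline e,\overline e'$ starting in $V_0$ with $r(\overline e)=r(\overline e')$ (same terminal vertex at the same level). *)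

(* Defs.v *)
From HB Require Import structures.
From mathcomp Require Import all_boot all_order all_algebra finmap.
From mathcomp Require Import all_classical all_reals all_analysis.

Set Implicit Arguments.
Unset Strict Implicit.
Unset Printing Implicit Defensive.

Import Order.TTheory GRing.Theory Num.Theory.

Local Open Scope classical_set_scope.
Local Open Scope ring_scope.

(* Every level V_n is a copy of one countably infinite set, so the vertices of
   all levels are elements of the single type [vertex]; the level is carried by
   the index n of [edge n] (edges between V_n and V_{n+1}), of the incidence
   matrices, and of the finite paths below. *)
Record graded_graph := GradedGraph {
  vertex : countType;
  vertex_infinite : infinite_set [set: vertex];
  edge : nat -> choiceType;
  source : forall n, edge n -> vertex;
  target : forall n, edge n -> vertex;
  edges_finite : forall n (w v : vertex),
    finite_set [set e : edge n | source e = w /\ target e = v] }.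

(* Rows are indexed by v in V_{n+1}, columns by w in V_n. *)
Definition incidence (G : graded_graph) (n : nat) (v w : vertex G) : nat :=
  #|` fset_set [set e : edge G n | source e = w /\ target e = v] |%fset.

Record generalized_bratteli := GeneralizedBratteli {
  graph :> graded_graph;
  row_finite : forall n (v : vertex graph),
    finite_set [set w | incidence n v w <> 0%N];
  row_neq0 : forall n (v : vertex graph), exists w, incidence n v w <> 0%N;
  col_neq0 : forall n (w : vertex graph), exists v, incidence n v w <> 0%N }.

Record path_space (B : generalized_bratteli) := PathSpace {
  path_edge :> forall n, edge B n;
  path_edgeP : forall n, target (path_edge n) = source (path_edge n.+1) }.

(* [fpath B n v] is E(V_0, v) for v in V_n; [FNil v] is the path of length zero
   at v in V_0, and [FSnoc p e] is the path p followed by the edge e. *)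
Inductive fpath (B : generalized_bratteli) : nat -> vertex B -> Type :=
| FNil (v : vertex B) : fpath 0 v
| FSnoc (n : nat) (e : edge B n) (p : fpath n (source e)) :
    fpath n.+1 (target e).

Fixpoint cylinder (B : generalized_bratteli) (n : nat) (v : vertex B)
    (p : fpath n v) : set (path_space B) :=
  match p with
  | FNil v => [set x | source (x 0%N) = v]
  | @FSnoc _ n e p => cylinder p `&` [set x | x n = e]
  end.

(* The library's measurable types are pointed, so an element of the path space
   has to be exhibited. *)
Section path_space_point.
Variable B : generalized_bratteli.

Lemma outgoing_edge_subproof n (w : vertex B) :
  exists e : edge B n, source e = w.
Proof.
have [v Fvw] := col_neq0 n w.
apply: contrapT => noe; apply: Fvw; rewrite /incidence.
suff -> : [set e : edge B n | source e = w /\ target e = v] = set0.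
  by rewrite fset_set0.
by rewrite -subset0 => e [ew _]; apply: noe; exists e.
Qed.

Lemma vertex_subproof : exists _ : vertex B, True.
Proof.
apply: contrapT => noV; apply: (vertex_infinite (g := B)).
suff -> : [set: vertex B] = set0 by exact: finite_set0.
by rewrite -subset0 => v _; apply: noV; exists v.
Qed.

Definition outgoing_edge n (w : vertex B) : edge B n :=
  projT1 (cid (outgoing_edge_subproof n w)).

Lemma source_outgoing_edge n (w : vertex B) : source (outgoing_edge n w) = w.
Proof. exact: projT2 (cid (outgoing_edge_subproof n w)). Qed.

Fixpoint point_edge n : edge B n :=
  match n with
  | 0%N => outgoing_edge 0 (projT1 (cid vertex_subproof))
  | m.+1 => outgoing_edge m.+1 (target (point_edge m))
  end.

Lemma point_edgeP n : target (point_edge n) = source (point_edge n.+1).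
Proof. by rewrite /= source_outgoing_edge. Qed.

Definition point_path : path_space B := PathSpace point_edgeP.

End path_space_point.

HB.instance Definition _ (B : generalized_bratteli) :=
  gen_eqMixin (path_space B).
HB.instance Definition _ (B : generalized_bratteli) :=
  gen_choiceMixin (path_space B).
HB.instance Definition _ (B : generalized_bratteli) :=
  isPointed.Build (path_space B) (point_path B).

Section path_space_topology.
Variable B : generalized_bratteli.

Definition path_open (U : set (path_space B)) : Prop :=
  forall x, U x -> exists n (v : vertex B) (p : fpath n v),
    cylinder p x /\ cylinder p `<=` U.

Lemma cylinderP n (v : vertex B) (p : fpath n v) (x y : path_space B) :
  cylinder p x -> cylinder p y <->
  source (y 0%N) = source (x 0%N) /\ forall i, (i < n)%N -> y i = x i.
Proof.
elim: p => [w|m e p IH] /=.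
  by move=> ->; split=> [->|[->]].
move=> [px xe]; split.
  move=> [py ye]; have [y0 yi] := (IH px).1 py; split=> // i.
  by rewrite ltnS leq_eqVlt => /predU1P[->|/yi//]; rewrite ye xe.
move=> [y0 yi]; split; last by rewrite yi.
by apply/(IH px); split=> // i im; apply: yi; apply: ltnW.
Qed.

Lemma path_openT : path_open setT.
Proof. by move=> x _; exists 0%N, (source (x 0%N)), (FNil (source (x 0%N))). Qed.

Lemma path_openI (U W : set (path_space B)) :
  path_open U -> path_open W -> path_open (U `&` W).
Proof.
move=> oU oW x [Ux Wx].
have [n [v [p [px pU]]]] := oU x Ux; have [m [w [q [qx qW]]]] := oW x Wx.
case/orP: (leq_total n m) => nm.
  exists m, w, q; split=> // y qy; split; last exact: qW.
  have [y0 yi] := (cylinderP y qx).1 qy.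
  by apply: pU; apply/(cylinderP y px); split=> // i /leq_trans/(_ nm)/yi.
exists n, v, p; split=> // y py; split; first exact: pU.
have [y0 yi] := (cylinderP y px).1 py.
by apply: qW; apply/(cylinderP y qx); split=> // i /leq_trans/(_ nm)/yi.
Qed.

Lemma path_open_bigU (I : Type) (f : I -> set (path_space B)) :
  (forall i, path_open (f i)) -> path_open (\bigcup_i f i).
Proof.
move=> of_ x [i _ fix_]; have [n [v [p [px pf]]]] := of_ i x fix_.
by exists n, v, p; split=> // y /pf; exists i.
Qed.

HB.instance Definition _ :=
  isOpenTopological.Build (path_space B) path_openT path_openI path_open_bigU.

End path_space_topology.

(* X_B with its Borel sigma-algebra. *)
Notation borel_path_space B := (g_sigma_algebraType (@open (path_space B))).

Section invariant_measures.
Variables (R : realType) (B : generalized_bratteli).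
Implicit Types (mu : set (path_space B) -> \bar R) (x : nat -> vertex B -> R).

Definition tail_invariant mu : Prop :=
  forall n (v : vertex B) (e e' : fpath n v), mu (cylinder e) = mu (cylinder e').

Definition cylinder_finite mu : Prop :=
  forall n (v : vertex B) (e : fpath n v), (mu (cylinder e) < +oo)%E.

(* x is the sequence of vectors mu^(n), with x n v = mu^(n)_v. *)
Definition cylinder_values mu x : Prop :=
  forall n (v : vertex B) (e : fpath n v), mu (cylinder e) = (x n v)%:E.

Definition incidence_tr (n : nat) (w v : vertex B) : nat := incidence n v w.

(* Columns of an incidence matrix may have infinitely many nonzero entries, so
   for y >= 0 this is a series with values in [0, +oo]. *)
Definition mulmv (A : vertex B -> vertex B -> nat) (y : vertex B -> R)
    (w : vertex B) : \bar R :=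
  (\esum_(v in [set: vertex B]) ((A w v)%:R * y v)%:E)%E.

Definition incidence_compatible x : Prop :=
  forall n (w : vertex B), mulmv (incidence_tr n) (x n.+1) w = (x n w)%:E.

(* A [{measure set _ -> _}] is a function on all sets that is only constrained
   on measurable ones, so uniqueness is equality on the Borel sets. *)
Definition exists_unique_measure
    (P : {measure set (borel_path_space B) -> \bar R} -> Prop) : Prop :=
  exists mu : {measure set (borel_path_space B) -> \bar R},
    P mu /\
    forall nu : {measure set (borel_path_space B) -> \bar R}, P nu ->
    forall A : set (borel_path_space B), measurable A -> nu A = mu A.

End invariant_measures.

(* Main.v *)
(* A cylinder ending at w in V_n is the disjoint union, over the countably many
   edges e with source w, of the cylinders prolonged by e, so countable
   additivity of a tail invariant measure is exactly A_n mu^(n+1) = mu^(n).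

   Conversely, a compatible sequence x gives a consistent mass to every set of
   paths that depends on finitely many edges.  Since a vertex may emit
   infinitely many edges, cylinders are not compact; countable additivity on
   this algebra comes instead from a tree argument: if it fails for a disjoint
   family F_i inside some cylinder, then, since both sides are additive over
   the one-edge prolongations of the cylinder, it fails inside one of these.
   Iterating produces an infinite path inside all the bad cylinders; but the
   cylinders around that path are eventually either contained in one F_i or
   disjoint from the union, where additivity is trivial.  Caratheodory's theorem
   extends the mass, and uniqueness holds because cylinders form a pi-system
   that generates the Borel sets and contains a countable cover by sets of
   finite mass. *)

Require Import Defs.
From HB Require Import structures.
From mathcomp Require Import all_boot all_order all_algebra finmap.
From mathcomp Require Import all_classical all_reals all_analysis.

Set Implicit Arguments.
Unset Strict Implicit.
Unset Printing Implicit Defensive.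

Import Order.TTheory GRing.Theory Num.Theory.

Local Open Scope classical_set_scope.
Local Open Scope ring_scope.

(** * Unordered sums and countable unions *)

Lemma esum_fibers (R : realType) (I T : choiceType) (A : set T) (D : set I)
    (f : T -> I) (a : T -> \bar R) :
  (forall t, A t -> (0 <= a t)%E) -> (forall t, A t -> D (f t)) ->
  (\esum_(t in A) a t =
   \esum_(i in D) \esum_(t in A `&` [set t | f t = i]) a t)%E.
Proof.
move=> a0 AD; rewrite esum_esum; last by move=> i t _ [At _]; exact: a0.
rewrite (reindex_esum A _ (fun t => (f t, t)))//; split.
- by move=> t At; split=> //; exact: AD.
- by move=> s t _ _ [].
- by move=> [i t] /= [Di [At <-]]; exists t.
Qed.

Lemma esum_exchange (R : realType) (S T : choiceType) (A : set S) (D : set T)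
    (a : S -> T -> \bar R) : (forall s t, 0 <= a s t)%E ->
  (\esum_(s in A) \esum_(t in D) a s t = \esum_(t in D) \esum_(s in A) a s t)%E.
Proof.
move=> a0; rewrite !esum_esum//.
rewrite (reindex_esum (D `*`` fun=> A) _ (fun p => (p.2, p.1)))//; split.
- by move=> [t s] [].
- by move=> [t s] [t' s'] _ _ [-> ->].
- by move=> [s t] [/= As Dt]; exists (t, s).
Qed.

(** Sigma-additivity is transported along an enumeration of [D], so that it applies to families
    indexed by paths. *)
Lemma measure_bigcup_countable d (T : measurableType d) (R : realType)
    (mu : {measure set T -> \bar R}) (I : choiceType) (D : set I)
    (F : I -> set T) :
  countable D -> (forall i, D i -> measurable (F i)) -> trivIset D F ->
  mu (\bigcup_(i in D) F i) = (\esum_(i in D) mu (F i))%E.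
Proof.
elim/choicePpointed: I => I in D F *.
  move=> _ _ _; rewrite (_ : D = set0) ?bigcup_set0 ?esum_set0 ?measure0//.
  by rewrite -subset0 => i; have := i; rewrite emptyE.
move=> /countable_bijP[N]; rewrite card_eq_sym => /card_set_bijP[f fbij] mF tF.
have [fN finj fsurj] := fbij.
have DE : D = f @` N.
  by apply/seteqP; split=> [i /fsurj//|_ [n Nn <-]]; exact: fN.
have mFf k : N k -> measurable (F (f k)) by move=> /fN; exact: mF.
rewrite (reindex_esum N D f)// [in LHS]DE bigcup_image measure_bigcup//.
  by rewrite nneseries_esum ?set_mem_set// => n _; exact: measure_ge0.
move=> m n Nm Nn FF; apply: finj; rewrite ?inE//.
by apply: tF => //; exact: fN.
Qed.

(** * Cylinders around infinite paths *)

Section paths.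
Variable B : generalized_bratteli.
Implicit Types (v w : vertex B) (y z : path_space B) (A : set (path_space B)).

(** The level-[n] cylinder around [y], free of the dependent type of finite paths. The condition on
    sources matters at [n = 0], where no edge is prescribed. *)
Definition agree n y : set (path_space B) :=
  [set z | source (z 0%N) = source (y 0%N) /\ forall i, (i < n)%N -> z i = y i].

Lemma agree_sym n y z : agree n y z -> agree n z y.
Proof. by move=> [yz0 yz]; split=> // i /yz ->. Qed.

Lemma agree_trans n y z u : agree n y z -> agree n z u -> agree n y u.
Proof.
move=> [yz0 yz] [zu0 zu]; split=> [|i lt_in]; first by rewrite zu0.
by rewrite zu// yz.
Qed.

Lemma agree_eq n y z : agree n y z -> agree n y = agree n z.
Proof.
move=> yz; apply/seteqP; split=> u; last exact: agree_trans.
by apply: agree_trans; exact: agree_sym.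
Qed.

Lemma agree_le m n y z : (m <= n)%N -> agree n y z -> agree m y z.
Proof.
by move=> mn [yz0 yz]; split=> // i im; apply: yz; exact: leq_trans mn.
Qed.

Lemma agreeS n y z : agree n.+1 y z <-> agree n y z /\ z n = y n.
Proof.
split=> [yz|[[yz0 yz] zn]]; first by split; [exact: agree_le yz|exact: yz.2].
by split=> // i; rewrite ltnS leq_eqVlt => /predU1P[->|/yz].
Qed.

Lemma agree_source n y z : agree n y z -> source (z n) = source (y n).
Proof. by case: n => [[]//|n] [_ yz]; rewrite -!path_edgeP yz. Qed.

(** Edges of different levels have different types, so [e] has to be cast to level [k] when
    [n = k]. *)
Definition edge_at n (e : edge B n) (k : nat) : option (edge B k) :=
  if @eqP _ n k is ReflectT nk then Some (ecast k (edge B k) nk e) else None.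

Lemma edge_at_id n (e : edge B n) : edge_at e n = Some e.
Proof. by rewrite /edge_at; case: eqP => // nn; rewrite eq_axiomK. Qed.

Lemma edge_at_neq n (e : edge B n) k : n != k -> edge_at e k = None.
Proof. by rewrite /edge_at; case: eqP. Qed.

Definition splice_choice n y (e : edge B n) k : option (edge B k) :=
  if (k < n)%N then Some (y k) else edge_at e k.

(** Follows [y] below level [n], takes [e] at level [n], then continues by arbitrary outgoing
    edges. *)
Fixpoint splice_edge n y (e : edge B n) k : edge B k :=
  odflt
    match k with
    | 0%N => outgoing_edge 0 (source (y 0%N))
    | k'.+1 => outgoing_edge k'.+1 (target (splice_edge y e k'))
    end (splice_choice y e k).

Lemma splice_edge_lt n y (e : edge B n) k : (k < n)%N ->
  splice_edge y e k = y k.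
Proof. by case: k => [|k] /= kn; rewrite /splice_choice kn. Qed.

Lemma splice_edge_eq n y (e : edge B n) : splice_edge y e n = e.
Proof.
by case: n e => [|n] e /=; rewrite /splice_choice ltnn edge_at_id.
Qed.

Lemma splice_edge_gt n y (e : edge B n) k : (n < k.+1)%N ->
  splice_edge y e k.+1 = outgoing_edge k.+1 (target (splice_edge y e k)).
Proof.
move=> nk /=.
by rewrite /splice_choice ltnNge ltnW//= edge_at_neq// ltn_eqF.
Qed.

(** At level 0 no edge precedes [e], so its source is free there; this lets a path start at any
    vertex. *)
Lemma splice n y (e : edge B n) : ((0 < n)%N -> source e = source (y n)) ->
  exists2 z : path_space B, forall i, (i < n)%N -> z i = y i & z n = e.
Proof.
move=> ey.
have P k : target (splice_edge y e k) = source (splice_edge y e k.+1).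
  have [kn|kn|kn] := ltngtP k.+1 n.
  - by rewrite !splice_edge_lt ?path_edgeP//; exact: ltnW.
  - by rewrite splice_edge_gt// source_outgoing_edge.
  - move: e ey; rewrite -kn => e ey.
    by rewrite splice_edge_lt// path_edgeP splice_edge_eq ey.
exists (PathSpace P) => [i|] /=; first exact: splice_edge_lt.
exact: splice_edge_eq.
Qed.

Lemma agree_splice n y (e : edge B n) : source e = source (y n) ->
  exists2 z, agree n y z & z n = e.
Proof.
move=> ey; have [z zy ze] := splice (fun _ => ey).
exists z => //; split=> //; case: n e ey zy ze => [|n] e ey zy ze.
  by rewrite ze.
by rewrite zy.
Qed.

(** A nonzero row provides an edge into [w]; by induction some path reaches its source and can be
    spliced with it. *)
Lemma vertex_reachable n (w : vertex B) :
  exists y : path_space B, source (y n) = w.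
Proof.
elim: n w => [|n IH] w.
  have [//|z _ z0] := @splice 0 (point_path B) (outgoing_edge 0 w).
  by exists z; rewrite z0 source_outgoing_edge.
have [w' F0] := row_neq0 n w.
have [e [es et]] : [set e : edge B n | source e = w' /\ target e = w] !=set0.
  apply: contrapT => /set0P/negP/negPn/eqP E; apply: F0.
  by rewrite /incidence E fset_set0.
have [y yw] := IH w'.
have [|z _ zn] := @agree_splice n y e; first by rewrite yw.
by exists z; rewrite -path_edgeP zn.
Qed.

Lemma edge_countable n : countable [set: edge B n].
Proof.
have -> : [set: edge B n] = \bigcup_(wv in [set: vertex B * vertex B])
    [set e : edge B n | source e = wv.1 /\ target e = wv.2].
  by apply/seteqP; split=> // e _; exists (source e, target e).
apply: bigcup_countable; first exact: countableP.
by move=> [w v] _; apply: finite_set_countable; exact: edges_finite.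
Qed.

Lemma cylinder_agree n v (p : Defs.fpath n v) y :
  cylinder p y -> cylinder p = agree n y.
Proof. by move=> py; apply/seteqP; split=> z /(cylinderP z py). Qed.

Lemma cylinder_source n v (p : Defs.fpath n v) y :
  cylinder p y -> source (y n) = v.
Proof. by case: p => //= m e p [_ <-]; rewrite path_edgeP. Qed.

Lemma cylinder_neq0 n v (p : Defs.fpath n v) : cylinder p !=set0.
Proof.
elim: p => [w|m e p [y py]] /=; first exact: vertex_reachable.
have [|z yz ze] := @agree_splice m y e; first by rewrite (cylinder_source py).
by exists z; rewrite (cylinder_agree py).
Qed.

Lemma agree_cylinder n y :
  exists p : Defs.fpath n (source (y n)), cylinder p = agree n y.
Proof.
(* The end vertex is left free because [FSnoc] ends at [target (y n)], which is only propositionally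
   [source (y n.+1)]. *)
suff [v [p py]] : exists (v : vertex B) (p : Defs.fpath n v), cylinder p y.
  have vE := cylinder_source py; subst v.
  by exists p; exact: cylinder_agree.
elim: n => [|n [v [p py]]]; first by exists (source (y 0%N)), (FNil _).
have vE := cylinder_source py; subst v.
by exists (target (y n)), (FSnoc p).
Qed.

(* Level-n cylinders are indexed by one path in each, so that sums over finite
   paths become sums over subsets of the path space. *)
Definition canon_path n y : path_space B := get (agree n y).

Lemma canonP n y : agree n y (canon_path n y).
Proof. by apply: (getPex (P := agree n y)); exists y. Qed.

Lemma canon_eq n y z : agree n y z <-> canon_path n y = canon_path n z.
Proof.
split=> [yz|E]; first by rewrite /canon_path (agree_eq yz).
apply: agree_trans (canonP n y) _; rewrite E.
by apply: agree_sym; exact: canonP.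
Qed.

Definition canonical_path n : set (path_space B) :=
  [set y | canon_path n y = y].

Lemma canonical_pathP n y : canonical_path n (canon_path n y).
Proof. by apply/esym/canon_eq; exact: canonP. Qed.

Lemma canonicalP n y z :
  canonical_path n y -> agree n y z <-> canon_path n z = y.
Proof.
by move=> {2}<-; split=> [/canon_eq->|E]; last by apply/canon_eq.
Qed.

(** The one-edge prolongations of a cylinder correspond bijectively to the edges leaving its end
    vertex. *)
Lemma esum_children (R : realType) n y (g : edge B n -> \bar R) :
  (\esum_(z in canonical_path n.+1 `&` agree n y) g (z n) =
   \esum_(e in [set e | source e = source (y n)]) g e)%E.
Proof.
apply/esym; apply: reindex_esum; split.
- by move=> z [_ /agree_source].
- move=> z u; rewrite !inE => -[cz yz] [cu yu] zu; rewrite -cz -cu.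
  apply/canon_eq/agreeS; split=> //.
  by apply: agree_trans (agree_sym yz) _.
- move=> e /= /agree_splice[z yz ze]; exists (canon_path n.+1 z).
    split; first exact: canonical_pathP.
    by apply: agree_trans yz _; apply: agree_le (canonP _ _).
  by have /agreeS[_ ->] := canonP n.+1 z.
Qed.

End paths.

(** Group the edges leaving [w] by target: each group is finite and its size is the incidence
    number. *)
Lemma mulmv_edges (R : realType) (B : generalized_bratteli) n (w : vertex B)
    (x : vertex B -> R) : (forall v, 0 <= x v) ->
  (mulmv (incidence_tr n) x w =
   \esum_(e in [set e : edge B n | source e = w]) (x (target e))%:E)%E.
Proof.
move=> x0; rewrite (@esum_fibers _ _ _ _ setT (@target B n))//; last first.
  by move=> e _; rewrite lee_fin.
apply: eq_esum => v _; rewrite -/([set e | source e = w] `&` _).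
have finE : finite_set ([set e : edge B n | source e = w] `&`
    [set e | target e = v]) by exact: edges_finite.
rewrite esum_fset//; last by move=> e _; rewrite lee_fin.
rewrite (eq_fsbigr (fun=> (x v)%:E)); last by move=> e /[!inE] -[_ ->].
rewrite fsbig_finite//= sumEFin big_const_seq count_predT iter_addr_0.
by rewrite mulr_natl.
Qed.

(** * Sets depending on finitely many edges *)

Section saturated.
Variable B : generalized_bratteli.
Implicit Types (y z : path_space B) (A : set (path_space B)).

(** These are the arbitrary, possibly infinite, unions of level-[n] cylinders. *)
Definition saturated n A := forall y z, agree n y z -> A y -> A z.

Lemma saturated_le m n A : (m <= n)%N -> saturated m A -> saturated n A.
Proof. by move=> mn sA y z /(agree_le mn); exact: sA. Qed.

Lemma saturated_agree n y : saturated n (agree n y).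
Proof. by move=> z u zu yz; exact: agree_trans zu. Qed.

Lemma saturatedI n A A' :
  saturated n A -> saturated n A' -> saturated n (A `&` A').
Proof. by move=> sA sA' y z yz [/(sA _ _ yz) ? /(sA' _ _ yz)]. Qed.

Lemma saturatedC n A : saturated n A -> saturated n (~` A).
Proof. by move=> sA y z yz Ay Az; apply/Ay/(sA z) => //; exact: agree_sym. Qed.

Definition finite_level : set (set (path_space B)) :=
  [set A | exists n, saturated n A].

Lemma finite_level0 : finite_level set0.
Proof. by exists 0%N. Qed.

Lemma finite_levelC : setC_closed finite_level.
Proof. by move=> A [n sA]; exists n; exact: saturatedC. Qed.

Lemma finite_levelU : setU_closed finite_level.
Proof.
move=> A A' [m sA] [n sA']; exists (maxn m n); rewrite -[A `|` A']setCK setCU.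
have sA1 := saturated_le (leq_maxl m n) sA.
have sA2 := saturated_le (leq_maxr m n) sA'.
exact: saturatedC (saturatedI (saturatedC sA1) (saturatedC sA2)).
Qed.

End saturated.

(* Cylinders do not form a semiring: the difference of two nested cylinders may
   be an infinite union of cylinders.  Hence the algebra of all sets that depend
   on finitely many edges. *)
Definition cylinder_algebra (B : generalized_bratteli) : Type := path_space B.
HB.instance Definition _ B := Pointed.on (cylinder_algebra B).
HB.instance Definition _ (B : generalized_bratteli) :=
  isAlgebraOfSets.Build default_measure_display (cylinder_algebra B)
    (@finite_level0 B) (@finite_levelU B) (@finite_levelC B).

(** * The mass on the algebra and its countable additivity *)

Section mass.
Variables (R : realType) (B : generalized_bratteli) (x : nat -> vertex B -> R).
Hypothesis x_ge0 : forall n v, 0 <= x n v.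
Hypothesis x_compatible : incidence_compatible x.
Implicit Types (y z : path_space B) (A : set (path_space B)).

Definition mass_at n A : \bar R :=
  (\esum_(y in canonical_path n `&` A) (x n (source (y n)))%:E)%E.

(* The level chosen by [get] is irrelevant by [massE]. *)
Definition mass A : \bar R := mass_at (get [set n | saturated n A]) A.

(** Group the level-[n.+1] cylinders in [A] by the level-[n] cylinder containing them; compatibility
    says that each group sums to the mass of its parent. *)
Lemma mass_atS n A : saturated n A -> mass_at n.+1 A = mass_at n A.
Proof.
move=> sA; rewrite /mass_at.
rewrite (@esum_fibers _ _ _ _ (canonical_path n `&` A) (canon_path n)).
- apply: eq_esum => y [cy Ay].
  rewrite (_ : _ `&` _ `&` _ = canonical_path n.+1 `&` agree n y); last first.
    apply/seteqP; split=> z /=.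
      by move=> [[cz _] zy]; split=> //; exact/canonicalP.
    move=> [cz yz]; split; first by split=> //; exact: sA yz Ay.
    exact/canonicalP.
  under eq_esum do rewrite -path_edgeP.
  rewrite (esum_children y (fun e => (x n.+1 (target e))%:E)).
  by rewrite -mulmv_edges.
- by move=> y _; rewrite lee_fin.
- move=> y [_ Ay]; split; first exact: canonical_pathP.
  exact: sA (canonP _ _) Ay.
Qed.

Lemma massE n A : saturated n A -> mass A = mass_at n A.
Proof.
move=> sA.
have mass_at_le k m : (k <= m)%N -> saturated k A -> mass_at m A = mass_at k A.
  move=> km sk; rewrite -(subnK km); elim: (m - k)%N => // i <-.
  by rewrite addSn mass_atS//; apply: saturated_le sk; rewrite leq_addl.
have sg : saturated (get [set n | saturated n A]) A.
  by apply: (getPex (P := [set n | saturated n A])); exists n.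
rewrite /mass; have [le|/ltnW le] := leqP (get [set n | saturated n A]) n.
  exact/esym/mass_at_le.
exact: mass_at_le.
Qed.

Lemma mass_ge0 A : (0 <= mass A)%E.
Proof. by apply: esum_ge0 => y _; rewrite lee_fin. Qed.

Lemma mass0 : mass set0 = 0%E.
Proof. by rewrite (@massE 0)// /mass_at setI0 esum_set0. Qed.

Lemma mass_agree n y : mass (agree n y) = (x n (source (y n)))%:E.
Proof.
rewrite (massE (@saturated_agree _ n y)) /mass_at.
rewrite (_ : _ `&` _ = [set canon_path n y]); last first.
  apply/seteqP; split=> [z [cz yz]|_ ->] /=.
    by rewrite -[LHS]cz; apply/esym/canon_eq.
  by split; [exact: canonical_pathP|exact: canonP].
by rewrite esum_set1 ?lee_fin// (agree_source (canonP n y)).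
Qed.

(** At the level [maxn k n] both [A] and its pieces are saturated, and the sum can be grouped by
    level-[k] cylinders. *)
Lemma mass_partition k A : finite_level A ->
  (mass A = \esum_(z in canonical_path k) mass (A `&` agree k z))%E.
Proof.
move=> [n sA]; have {}sA := saturated_le (leq_maxr k n) sA.
rewrite (massE sA) /mass_at.
rewrite (@esum_fibers _ _ _ _ (canonical_path k) (canon_path k)).
- apply: eq_esum => z cz.
  rewrite (@massE (maxn k n)); last first.
    apply: saturatedI => //; apply: saturated_le (leq_maxl k n) _.
    exact: saturated_agree.
  congr esum; apply/seteqP; split=> u /=.
    by move=> [[cu Au] uz]; split=> //; split=> //; exact/canonicalP.
  by move=> [cu [Au zu]]; split; [split|exact/canonicalP].
- by move=> y _; rewrite lee_fin.
- by move=> y _; exact: canonical_pathP.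
Qed.

Lemma mass_sigma_additive (F : (set (path_space B))^nat) :
  (forall i, finite_level (F i)) -> trivIset setT F ->
  finite_level (\bigcup_i F i) ->
  mass (\bigcup_i F i) = (\sum_(i <oo) mass (F i))%E.
Proof.
move=> mF tF mU; set U := \bigcup_i F i.
pose good S := mass (U `&` S) = (\sum_(i <oo) mass (F i `&` S))%E.
have mI A A' : finite_level A -> finite_level A' -> finite_level (A `&` A').
  move=> [i sA] [j sA']; exists (maxn i j).
  by apply: saturatedI; [apply: saturated_le sA|apply: saturated_le sA'];
    rewrite ?leq_maxl ?leq_maxr.
(* Both sides split over the level-[k] cylinders; on the right, the two sums of nonnegative terms
   are exchanged. *)
have good_children S k : finite_level S ->
    (forall z, good (S `&` agree k z)) -> good S.
  move=> mS gS; rewrite /good (mass_partition k); last exact: mI.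
  under eq_esum do rewrite -setIA gS.
  under [RHS]eq_eseriesr => i _.
    rewrite (mass_partition k (mI _ _ (mF i) mS)).
    under eq_esum do rewrite -setIA.
    over.
  rewrite nneseries_esumT; last first.
    by move=> i; apply: esum_ge0 => *; exact: mass_ge0.
  under eq_esum => z _.
    rewrite nneseries_esumT; last by move=> i; exact: mass_ge0.
    over.
  by rewrite esum_exchange// => *; exact: mass_ge0.
suff : good setT.
  by rewrite /good setIT => ->; under eq_eseriesr do rewrite setIT.
apply: contrapT => bad.
have step n y : ~ good (agree n y) ->
    exists2 z, agree n y z & ~ good (agree n.+1 z).
  move=> b; apply: contrapT => noz; apply: b.
  apply: (good_children _ n.+1); first by exists n; exact: saturated_agree.
  (* The intersection is either a prolongation of [agree n y] or empty, and additivity on the empty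
     set is trivial. *)
  move=> z; have [[u [yu zu]]|E] := pselect (agree n y `&` agree n.+1 z !=set0).
    rewrite (_ : _ `&` _ = agree n.+1 u); last first.
      rewrite (agree_eq zu) (agree_eq yu).
      apply/seteqP; split=> [t []//|t ut]; split=> //.
      exact: agree_le (leqnSn n) ut.
    by apply: contrapT => gu; apply: noz; exists u.
  rewrite (_ : _ `&` _ = set0); last by apply: contrapT => /eqP/set0P.
  by rewrite /good setI0 mass0 eseries0// => i _ _; rewrite setI0 mass0.
have [y0 bad0] : exists y, ~ good (agree 0 y).
  apply: contrapT => noy; apply: bad; apply: (good_children _ 0%N).
    by exists 0%N.
  by move=> z; rewrite setTI; apply: contrapT => gz; apply: noy; exists z.
have [y [yS ybad]] : exists y : nat -> path_space B,
    (forall n, agree n (y n) (y n.+1)) /\ forall n, ~ good (agree n (y n)).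
  (* Dependent choice: [next] is meaningful only on bad cylinders, and [y] never leaves them. *)
  pose next n z : path_space B :=
    get [set u | agree n z u /\ ~ good (agree n.+1 u)].
  have nextP n z : ~ good (agree n z) ->
      agree n z (next n z) /\ ~ good (agree n.+1 (next n z)).
    move=> /step[u zu gu].
    by apply: (getPex (P := [set u | agree n z u /\ _])); exists u.
  pose y := fix y n := if n is m.+1 then next m (y m) else y0.
  have ybad n : ~ good (agree n (y n)) by elim: n => // n /nextP[].
  by exists y; split=> // n; have [] := nextP _ _ (ybad n).
have y_le m n : (m <= n)%N -> agree m (y m) (y n).
  move=> mn; rewrite -(subnKC mn); elim: (n - m)%N => [|k IH].
    by rewrite addn0.
  rewrite addnS; apply: agree_trans IH _; apply: agree_le (yS _).
  by rewrite leq_addr.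
(* The limit path takes its edge [n] from [y n.+1], since the cylinder around [y n] fixes only the
   edges below [n]. *)
have limP n : target (y n.+1 n) = source (y n.+2 n.+1).
  by rewrite path_edgeP (agree_source (yS n.+1)).
pose l := PathSpace limP.
have yl n : agree n (y n) l.
  split=> [|i lt_in] /=.
    by have [-> _] := y_le 0%N n isT; have [-> _] := y_le 0%N 1%N isT.
  by have [_ ->] := y_le _ _ lt_in.
have {}ybad n : ~ good (agree n l) by rewrite -(agree_eq (yl n)).
have agreeIout n A : saturated n A -> ~ A l -> A `&` agree n l = set0.
  move=> sA Al; rewrite -subset0 => z [Az lz].
  by apply/Al/(sA z) => //; exact: agree_sym.
have agreeIin n A : saturated n A -> A l -> A `&` agree n l = agree n l.
  by move=> sA Al; apply/setIidPr => z lz; exact: sA Al.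
(* If [l] is outside [U], a small cylinder around [l] misses [U] and both sides vanish; if [l] is in
   [F i], a small cylinder lies in [F i] and only the term [i] survives. *)
have [[i _ Fil]|Ul] := pselect (U l); last first.
  have [n sU] := mU; apply: (ybad n).
  rewrite /good agreeIout// mass0 eseries0// => i _ _.
  rewrite (_ : _ `&` _ = set0) ?mass0// -subset0.
  by rewrite -(agreeIout n U sU Ul); apply: setSI; exact: bigcup_sup.
have [n sF] := mF i; apply: (ybad n); rewrite /good.
rewrite (_ : U `&` _ = agree n l); last first.
  apply/setIidPr; apply: subset_trans (bigcup_sup _) => //.
  by rewrite -(agreeIin n (F i))//; exact: subIsetl.
rewrite (@nneseriesD1 _ _ i)//; last by move=> j _; exact: mass_ge0.
rewrite agreeIin// eseries0 ?adde0// => j _ /= ji.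
rewrite (_ : _ `&` _ = set0) ?mass0// -subset0 => z [Fjz lz].
move/eqP: ji; apply; apply: tF => //; exists z; split=> //; exact: sF Fil.
Qed.

End mass.

(** * Cylinders as a countable generating pi-system *)

Section borel.
Variable B : generalized_bratteli.

Definition cylinders : set (set (path_space B)) :=
  [set A | A = set0 \/ exists n y, A = agree n y].

Lemma cylinders_agree n (y : path_space B) : cylinders (agree n y).
Proof. by right; exists n, y. Qed.

Lemma cylinders_cylinder n (v : vertex B) (p : Defs.fpath n v) :
  cylinders (cylinder p).
Proof.
have [y py] := cylinder_neq0 p; rewrite (cylinder_agree py).
exact: cylinders_agree.
Qed.

Lemma cylinders_agreeI m n (y z : path_space B) : (m <= n)%N ->
  cylinders (agree m y `&` agree n z).
Proof.
move=> mn; have [[u [yu zu]]|E] := pselect (agree m y `&` agree n z !=set0).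
  rewrite (_ : _ `&` _ = agree n z); first exact: cylinders_agree.
  apply/setIidPr => t zt; apply: agree_trans yu _; apply: agree_le mn _.
  by apply: agree_trans zt; exact: agree_sym.
by left; apply: contrapT => /eqP/set0P.
Qed.

Lemma setI_closed_cylinders : setI_closed cylinders.
Proof.
move=> A A' [->|[m [y ->]]]; first by rewrite set0I; left.
move=> [->|[n [z ->]]]; first by rewrite setI0; left.
have [mn|/ltnW nm] := leqP m n; first exact: cylinders_agreeI.
by rewrite setIC; exact: cylinders_agreeI.
Qed.

(** A cylinder of level [n.+1] is determined by one of level [n] and an edge, and each edge set is
    countable. *)
Lemma countable_agree n : countable (range (@agree B n)).
Proof.
elim: n => [|n IH].
  pose h (v : vertex B) : set (path_space B) := [set x | source (x 0%N) = v].
  apply: (@sub_countable _ _ _ (range h)); last first.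
    exact: card_le_trans (card_image_le h setT) (countableP _).
  apply: subset_card_le => _ [y _ <-]; exists (source (y 0%N)) => //.
  by apply/seteqP; split=> z //= [].
pose h (p : set (path_space B) * edge B n) :=
  p.1 `&` [set x : path_space B | x n = p.2].
apply: (@sub_countable _ _ _ (h @` (range (@agree B n) `*` setT))); last first.
  apply: card_le_trans (card_image_le h _) _.
  by apply: countableX => //; exact: edge_countable.
apply: subset_card_le => _ [y _ <-]; exists (agree n y, y n).
  by split=> //; exists y.
by apply/seteqP; split=> z /agreeS.
Qed.

Lemma countable_canonical_path n : countable (@canonical_path B n).
Proof.
apply: (@sub_countable _ _ _ ((get : _ -> path_space B) @` range (@agree B n))).
  by apply: subset_card_le => y cy; exists (agree n y) => //; exists y.
exact: card_le_trans (card_image_le _ _) (countable_agree n).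
Qed.

Lemma countable_cylinders : countable cylinders.
Proof.
rewrite (_ : cylinders = \bigcup_(o in [set: option nat])
    if o is Some n then range (@agree B n) else [set set0]).
  apply: bigcup_countable; first exact: countableP.
  by move=> [n|] _; [exact: countable_agree|exact: countable1].
apply/seteqP; split=> A.
  by move=> [->|[n [y ->]]]; [exists None|exists (Some n) => //; exists y].
by move=> [[n|] _]; [move=> [y _ <-]; exact: cylinders_agree|left].
Qed.

Lemma open_bigcup_cylinders (U : set (path_space B)) : open U ->
  U = \bigcup_(A in cylinders `&` [set A | A `<=` U]) A.
Proof.
move=> oU; apply/seteqP; split=> [x /oU[n [v [p [px pU]]]]|x [A [_ AU] /AU]//].
by exists (cylinder p) => //; split=> //; exact: cylinders_cylinder.
Qed.

Lemma open_agree n (y : path_space B) : open (agree n y).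
Proof.
move=> x yx; have [p pE] := agree_cylinder n y.
by exists n, _, p; rewrite pE; split.
Qed.

Lemma measurable_agree n (y : path_space B) :
  measurable (agree n y : set (borel_path_space B)).
Proof. by apply: sub_sigma_algebra; exact: open_agree. Qed.

Lemma measurable_cylinders (A : set (borel_path_space B)) :
  cylinders A -> measurable A.
Proof.
by move=> [->|[n [y ->]]]; [exact: measurable0|exact: measurable_agree].
Qed.

(** An open set is the union of the cylinders it contains, and there are only countably many
    cylinders. *)
Lemma borel_cylinders : <<s @open (path_space B) >> = <<s cylinders >>.
Proof.
apply/seteqP; split; apply: smallest_sub; try exact: smallest_sigma_algebra.
  move=> U /open_bigcup_cylinders->.
  rewrite bigcup_set_type.
  apply: (@countable_bigcupT_measurable _ (g_sigma_algebraType cylinders)).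
    rewrite (eq_countable (card_setT _)).
    apply: (@sub_countable _ _ _ cylinders); last exact: countable_cylinders.
    by apply: subset_card_le; exact: subIsetl.
  by move=> A; apply: sub_sigma_algebra; have [] := set_valP A.
by move=> A /measurable_cylinders.
Qed.

End borel.

(** * Sigma-finiteness and uniqueness *)

Section uniqueness.
Variables (R : realType) (B : generalized_bratteli).
Implicit Types (mu nu : {measure set (borel_path_space B) -> \bar R}).

(** A sequence of cylinders covering the space, indexed by codes of vertices of [V_0]; a number
    coding no vertex gives the empty set. *)
Definition initial_cylinder (k : nat) : set (path_space B) :=
  if choice.unpickle k is Some v then cylinder (FNil v) else set0.

Lemma initial_cylinderP k : cylinders (initial_cylinder k).
Proof.
rewrite /initial_cylinder; case: choice.unpickle => [v|]; last by left.
exact: cylinders_cylinder.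
Qed.

Lemma bigcup_initial_cylinder : \bigcup_k initial_cylinder k = setT.
Proof.
apply/seteqP; split=> // y _; exists (choice.pickle (source (y 0%N))) => //.
by rewrite /initial_cylinder choice.pickleK.
Qed.

Lemma initial_cylinder_finite mu k :
  cylinder_finite mu -> (mu (initial_cylinder k) < +oo)%E.
Proof.
move=> fmu; rewrite /initial_cylinder; case: choice.unpickle => [v|]; last first.
  by rewrite measure0.
exact: fmu.
Qed.

Lemma cylinder_finite_sigma_finite mu :
  cylinder_finite mu -> sigma_finite [set: borel_path_space B] mu.
Proof.
move=> fmu; exists initial_cylinder; first by rewrite bigcup_initial_cylinder.
move=> k; split; last exact: initial_cylinder_finite.
by apply: measurable_cylinders; exact: initial_cylinderP.
Qed.

Lemma cylinder_values_finite mu x : cylinder_values mu x -> cylinder_finite mu.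
Proof. by move=> mux n v p; rewrite mux ltry. Qed.

Lemma cylinder_values_tail_invariant mu x :
  cylinder_values mu x -> tail_invariant mu.
Proof. by move=> mux n v p q; rewrite !mux. Qed.

Lemma cylinder_values_inj mu nu x :
  cylinder_values mu x -> cylinder_values nu x ->
  forall A, measurable A -> mu A = nu A.
Proof.
move=> mux nux A mA.
refine (@g_sigma_algebra_measure_unique _ _ _ _ (@measurable_cylinders B) _
  initial_cylinderP bigcup_initial_cylinder mu nu (@setI_closed_cylinders B)
  _ _ A _).
- move=> _ [->|[n [y ->]]]; first by rewrite !measure0.
  by have [p <-] := agree_cylinder n y; rewrite mux nux.
- by move=> k; apply: initial_cylinder_finite; exact: cylinder_values_finite mux.
- by rewrite -borel_cylinders.
Qed.

End uniqueness.

(** * From a measure to its vectors *)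

Section values.
Variables (R : realType) (B : generalized_bratteli).
Variable mu : {measure set (borel_path_space B) -> \bar R}.

Lemma cylinder_values_agree x n (y : path_space B) : cylinder_values mu x ->
  mu (agree n y) = (x n (source (y n)))%:E.
Proof. by move=> mux; have [p <-] := agree_cylinder n y; exact: mux. Qed.

Lemma cylinder_values_exists_unique :
  cylinder_finite mu -> tail_invariant mu -> exists! x, cylinder_values mu x.
Proof.
move=> fmu imu.
(* Measure the cylinder of any path through [v]; tail invariance makes the choice immaterial, and
   finiteness justifies [fine]. *)
pose x n v := fine (mu (agree n (projT1 (cid (@vertex_reachable B n v))))).
exists x; split.
  move=> n v p; rewrite /x; case: cid => y /= yv.
  have [q qE] := agree_cylinder n y; move: q qE; rewrite yv => q <-.
  by rewrite (imu _ _ q p) fineK// fin_num_abs gee0_abs//; exact: fmu.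
move=> x' mux'; apply/funext => n; apply/funext => v; rewrite /x.
by case: cid => y /= yv; rewrite (cylinder_values_agree _ _ mux') yv.
Qed.

Lemma cylinder_values_compatible x :
  cylinder_values mu x -> incidence_compatible x.
Proof.
move=> mux n w.
(* Every vertex ends some cylinder, so its value is a measure. *)
have x_ge0 m v : 0 <= x m v.
  have [y <-] := vertex_reachable m v.
  by rewrite -lee_fin -(cylinder_values_agree m y mux) measure_ge0.
have [y yw] := vertex_reachable n w.
rewrite mulmv_edges// -yw -(cylinder_values_agree n y mux).
rewrite -(esum_children y (fun e => (x n.+1 (target e))%:E)).
rewrite [in RHS](_ : agree n y =
  \bigcup_(z in canonical_path n.+1 `&` agree n y) agree n.+1 z); last first.
  apply/seteqP; split=> [z yz|u [z [_ yz] zu]].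
    exists (canon_path n.+1 z); last by apply: agree_sym; exact: canonP.
    split; first exact: canonical_pathP.
    by apply: agree_trans yz _; apply: agree_le (leqnSn n) (canonP _ _).
  by apply: agree_trans yz _; apply: agree_le (leqnSn n) zu.
rewrite measure_bigcup_countable.
- by apply: eq_esum => z _; rewrite (cylinder_values_agree _ _ mux) path_edgeP.
- apply: (@sub_countable _ _ _ (canonical_path n.+1)).
    by apply: subset_card_le; exact: subIsetl.
  exact: countable_canonical_path.
- by move=> z _; exact: measurable_agree.
- move=> z u [cz _] [cu _] [t [zt ut]]; rewrite -cz -cu; apply/canon_eq.
  by apply: agree_trans zt _; exact: agree_sym.
Qed.

End values.

(** * Caratheodory extension of the mass *)

Lemma borel_sub_cylinder_algebra (B : generalized_bratteli) :
  <<s @open (path_space B) >> `<=` <<s @finite_level B >>.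
Proof.
rewrite borel_cylinders; apply: smallest_sub.
  exact: smallest_sigma_algebra.
move=> _ [->|[n [y ->]]]; apply: sub_sigma_algebra.
  exact: finite_level0.
by exists n; exact: saturated_agree.
Qed.

Section existence.
Variables (R : realType) (B : generalized_bratteli) (x : nat -> vertex B -> R).
Hypothesis x_ge0 : forall n v, 0 <= x n v.
Hypothesis x_compatible : incidence_compatible x.

Let premeasure : set (cylinder_algebra B) -> \bar R := mass x.

Let premeasure_semi_sigma_additive : semi_sigma_additive premeasure.
Proof.
move=> F mF tF mU; rewrite /premeasure mass_sigma_additive//.
by apply: is_cvg_nneseries => n _ _; exact: mass_ge0.
Qed.

HB.instance Definition _ := isMeasure.Build _ _ _ premeasure
  (mass0 x_ge0 x_compatible) (mass_ge0 x_ge0) premeasure_semi_sigma_additive.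

(** The extension is a measure on the sigma-algebra generated by [finite_level];
    [borel_sub_cylinder_algebra] allows restricting it to the Borel sets. *)
Let extension : set (borel_path_space B) -> \bar R :=
  measure_extension [the measure _ _ of premeasure].

Let extension0 : extension set0 = 0%E.
Proof. exact: measure0. Qed.

Let extension_ge0 A : (0 <= extension A)%E.
Proof. exact: measure_ge0. Qed.

Let extension_semi_sigma_additive : semi_sigma_additive extension.
Proof.
move=> F mF tF mU; apply: measure_semi_sigma_additive => //.
- by move=> n; apply: borel_sub_cylinder_algebra; exact: mF.
- exact: borel_sub_cylinder_algebra.
Qed.

HB.instance Definition _ := isMeasure.Build _ _ _ extension
  extension0 extension_ge0 extension_semi_sigma_additive.

Lemma cylinder_values_exists :
  exists mu : {measure set (borel_path_space B) -> \bar R},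
    cylinder_values mu x.
Proof.
exists [the measure _ _ of extension] => n v p /=.
have [y py] := cylinder_neq0 p.
(* On the algebra the outer measure coincides with [mass]. *)
rewrite (cylinder_agree py) /extension /measure_extension measurable_mu_extE.
  by rewrite /= /premeasure mass_agree// (cylinder_source py).
by exists n; exact: saturated_agree.
Qed.

End existence.

Theorem theorem2p13 (R : realType) (B : generalized_bratteli) :
  [/\ (* tail invariant probability measures *)
      forall mu : probability (borel_path_space B) R,
        tail_invariant mu ->
        (exists! x, cylinder_values mu x) /\
        (forall x, cylinder_values mu x -> incidence_compatible x),
      (* converse *)
      forall x : nat -> vertex B -> R,
        (forall n v, 0 <= x n v) -> incidence_compatible x ->
        exists_unique_measure (fun mu =>
          tail_invariant mu /\ cylinder_values mu x),
      (* sigma-finite measures, finite on cylinder sets *)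
      forall nu : {measure set (borel_path_space B) -> \bar R},
        sigma_finite [set: borel_path_space B] nu ->
        cylinder_finite nu ->
        tail_invariant nu ->
        (exists! x, cylinder_values nu x) /\
        (forall x, cylinder_values nu x -> incidence_compatible x)
    & (* converse, sigma-finite case *)
      forall x : nat -> vertex B -> R,
        (forall n v, 0 <= x n v) -> incidence_compatible x ->
        exists_unique_measure (fun nu =>
          [/\ sigma_finite [set: borel_path_space B] nu,
              cylinder_finite nu, tail_invariant nu
            & cylinder_values nu x]) ].
Proof.
split.
- move=> mu imu; split; last by move=> x; exact: cylinder_values_compatible.
  apply: cylinder_values_exists_unique => // n v p.
  have [y py] := cylinder_neq0 p; rewrite (cylinder_agree py).
  apply: (le_lt_trans (probability_le1 mu (measurable_agree n y))).
  exact: ltry.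
- move=> x x0 xc; have [mu mux] := cylinder_values_exists x0 xc.
  exists mu; split; first by split=> //; exact: cylinder_values_tail_invariant mux.
  by move=> nu [_ nux] A; exact: cylinder_values_inj nux mux A.
- move=> nu _ fnu inu; split; first exact: cylinder_values_exists_unique.
  by move=> x; exact: cylinder_values_compatible.
- move=> x x0 xc; have [mu mux] := cylinder_values_exists x0 xc.
  have fmu := cylinder_values_finite mux.
  exists mu; split.
    split=> //; first exact: cylinder_finite_sigma_finite.
    exact: cylinder_values_tail_invariant mux.
  by move=> nu [_ _ _ nux] A; exact: cylinder_values_inj nux mux A.
Qed.
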